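(* Let $(\mathfrak g,[-,-],\rhd)$ be a post-Lie algebra over a field $\mathbf k$ of characteristic $p>0$, let $\mathrm U(\mathfrak g)$ be the universal enveloping algebra of $(\mathfrak g,[-,-])$ with the Guin-Oudom extension of $\rhd$, and let $\mathfrak g^{(p)}=\mathrm{span}_{\mathbf k}\{x^{p^k}\in\mathrm U(\mathfrak g)\mid x\in\mathfrak g,\ k\ge0\}$ be the space of primitive elements of $\mathrm U(\mathfrak g)$. Then in $\mathrm U(\mathfrak g)$ $$y\rhd x^p=[\underbrace{x,[x,[\cdots[x}_{p-1},y\rhd x]\cdots]]],\qquad x,y\in\mathfrak g^{(p)},$$ where $[-,-]$ is the commutator of $\mathrm U(\mathfrak g)$.
   Context: Convention: $\mathbf k$ is an algebraically closed field of prime characteristic $p$; everything is over $\mathbf k$. Post-Lie algebra: a Lie algebra $(\mathfrak g,[-,-])$ with a bilinear product $\rhd$ such that $x\rhd[y,z]=[x\rhd y,z]+[y,x\rhd z]$ and $([x,y]+x\rhd y-y\rhd x)\rhd z=x\rhd(y\rhd z)-y\rhd(x\rhd z)$. Guin-Oudom extension: $\mathrm U(\mathfrak g)$ carries its usual cocommutative Hopf structure (elements of $\mathfrak g$ primitive; Sweedler notation $\Delta(x)=x_1\otimes x_2$; counit $\varepsilon$). The product $\rhd$ of $\mathfrak g$ extends uniquely to a coalgebra map $\rhd:\mathrm U(\mathfrak g)\otimes\mathrm U(\mathfrak g)\to\mathrm U(\mathfrak g)$ with $1\rhd z=z$, $x\rhd1=\varepsilon(x)1$, $x\rhd(yz)=(x_1\rhd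 y)(x_2\rhd z)$ and $x\rhd(y\rhd z)=(x_1(x_2\rhd y))\rhd z$ for all $x,y,z\in\mathrm U(\mathfrak g)$. *)

(* Defs.v *)
From HB Require Import structures.
From mathcomp Require Import all_boot all_order all_algebra.

Set Implicit Arguments.
Unset Strict Implicit.
Unset Printing Implicit Defensive.

Import GRing.Theory.
Local Open Scope ring_scope.

HB.mixin Record Lmodule_isLieAlgebra (k : fieldType) L of GRing.Lmodule k L := {
  lie_bracket : L -> L -> L;
  lie_bracket_bilinear : bilinear_for *:%R *:%R lie_bracket;
  lie_bracketxx : forall x, lie_bracket x x = 0;
  lie_jacobi : forall x y z,
    lie_bracket x (lie_bracket y z) + lie_bracket y (lie_bracket z x)
      + lie_bracket z (lie_bracket x y) = 0
}.

#[short(type="lieAlgType")]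
HB.structure Definition LieAlgebra (k : fieldType) :=
  {L of GRing.Lmodule k L & Lmodule_isLieAlgebra k L}.

HB.mixin Record LieAlgebra_isPostLie (k : fieldType) L of LieAlgebra k L := {
  post_prod : L -> L -> L;
  post_prod_bilinear : bilinear_for *:%R *:%R post_prod;
  post_prod_bracket : forall x y z : L,
    post_prod x (lie_bracket y z)
      = lie_bracket (post_prod x y) z + lie_bracket y (post_prod x z);
  post_bracket_prod : forall x y z : L,
    post_prod (lie_bracket x y + post_prod x y - post_prod y x) z
      = post_prod x (post_prod y z) - post_prod y (post_prod x z)
}.

#[short(type="postLieAlgType")]
HB.structure Definition PostLieAlgebra (k : fieldType) :=
  {L of LieAlgebra k L & LieAlgebra_isPostLie k L}.

Definition commutator (A : nzRingType) (u v : A) : A := u * v - v * u.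

Definition lie_to_alg (k : fieldType) (g : lieAlgType k) (A : algType k)
    (f : g -> A) : Prop :=
  forall x y : g, f (lie_bracket x y) = commutator (f x) (f y).

(* The pair (U, i) is a universal enveloping algebra of g, characterized up to
   unique isomorphism by its universal property. *)
Record is_enveloping_algebra (k : fieldType) (g : lieAlgType k)
    (U : algType k) (i : {linear g -> U}) : Prop := IsEnvelopingAlgebra {
  enveloping_lie : lie_to_alg i;
  enveloping_universal : forall (A : algType k) (f : {linear g -> A}),
    lie_to_alg f ->
    exists F : {lrmorphism U -> A},
      (forall x, F (i x) = f x) /\
      (forall F' : {lrmorphism U -> A}, (forall x, F' (i x) = f x) -> F' =1 F)
}.

(* The algebra T, with t a b standing for the pure tensor of a and b, is the
   tensor product of the algebras A and B: it has the universal property of the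
   tensor product of vector spaces, and the componentwise multiplication. *)
Record is_tensor_algebra (k : fieldType) (A B T : algType k)
    (t : {bilinear A -> B -> T}) : Prop := IsTensorAlgebra {
  tensor_universal : forall (W : lmodType k) (b : {bilinear A -> B -> W}),
    exists F : {linear T -> W},
      (forall x y, F (t x y) = b x y) /\
      (forall F' : {linear T -> W}, (forall x y, F' (t x y) = b x y) -> F' =1 F);
  tensor1 : t 1 1 = 1;
  tensorM : forall a b c d, t a b * t c d = t (a * c) (b * d)
}.

(* The coproduct D and counit e of an enveloping algebra; as morphisms of
   algebras they are determined by their values on the Lie algebra. *)
Record is_enveloping_coalgebra (k : fieldType) (g : lieAlgType k)
    (U T : algType k) (i : {linear g -> U}) (t : {bilinear U -> U -> T})
    (D : {lrmorphism U -> T}) (e : {lrmorphism U -> k^o}) : Prop :=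
  IsEnvelopingCoalgebra {
  coproduct_primitive : forall x : g, D (i x) = t (i x) 1 + t 1 (i x);
  counit_primitive : forall x : g, e (i x) = 0
}.

(* Sweedler notation: s is a list of pairs (x_1, x_2) such that the coproduct
   of x is the sum of the pure tensors of the x_1 and x_2.  Such an s is not
   unique; identities in Sweedler notation are required for all of them. *)
Definition sweedler (k : fieldType) (U T : algType k)
    (t : {bilinear U -> U -> T}) (D : U -> T) (x : U) (s : seq (U * U)) : Prop :=
  D x = \sum_(a <- s) t a.1 a.2.

Record is_guin_oudom (k : fieldType) (g : postLieAlgType k)
    (U T : algType k) (i : {linear g -> U}) (t : {bilinear U -> U -> T})
    (D : {lrmorphism U -> T}) (e : {lrmorphism U -> k^o})
    (r : {bilinear U -> U -> U}) : Prop := IsGuinOudom {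
  guin_oudom_extends : forall x y : g, r (i x) (i y) = i (post_prod x y);
  guin_oudom_coproduct : forall (x y : U) (s u : seq (U * U)),
    sweedler t D x s -> sweedler t D y u ->
    D (r x y) = \sum_(a <- s) \sum_(b <- u) t (r a.1 b.1) (r a.2 b.2);
  guin_oudom_counit : forall x y : U, e (r x y) = e x * e y;
  guin_oudom1l : forall z : U, r 1 z = z;
  guin_oudom1r : forall x : U, r x 1 = (e x : k) *: 1;
  guin_oudomM : forall (x y z : U) (s : seq (U * U)), sweedler t D x s ->
    r x (y * z) = \sum_(a <- s) r a.1 y * r a.2 z;
  guin_oudomA : forall (x y z : U) (s : seq (U * U)), sweedler t D x s ->
    r x (r y z) = r (\sum_(a <- s) a.1 * r a.2 y) z
}.

Definition in_frobenius_span (k : fieldType) (g : lieAlgType k)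
    (U : algType k) (i : {linear g -> U}) (p : nat) (u : U) : Prop :=
  exists s : seq (k * g * nat),
    u = \sum_(c <- s) c.1.1 *: i c.1.2 ^+ (p ^ c.2).

(* Main.v *)
(* A primitive element y acts through r as a derivation, so r y (x ^+ p) is the
   sum of the x ^+ (p - 1 - j) * r y x * x ^+ j.  The same sum is (ad x)^(p-1)
   applied to r y x, because (-1) ^+ j * 'C(p - 1, j) = 1 in characteristic p.
   Elements of the span of the i a ^+ (p ^ n) are primitive by the Frobenius
   formula for the commuting elements i a (x) 1 and 1 (x) i a. *)
Require Import Defs.
From HB Require Import structures.
From mathcomp Require Import all_boot all_order all_algebra.

Set Implicit Arguments.
Unset Strict Implicit.
Unset Printing Implicit Defensive.

Import GRing.Theory.
Local Open Scope ring_scope.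

Lemma iter_commutatorE (A : nzRingType) (x z : A) (n : nat) :
  iter n (commutator x) z =
  \sum_(j < n.+1) (-1) ^+ j * (x ^+ (n - j) * z * x ^+ j) *+ 'C(n, j).
Proof.
elim: n => [|n IHn]; first by rewrite big_ord1 !expr0 !mul1r mulr1.
rewrite iterS IHn /commutator mulr_sumr mulr_suml.
rewrite big_ord_recl [RHS]big_ord_recl [X in _ - X]big_ord_recr /=.
rewrite !bin0 !binn !subn0 !expr0 !mul1r !mulr1 !mulr1n mulrA -exprS.
rewrite opprD addrA -addrA -addrA; congr (_ + _).
rewrite [RHS]big_ord_recr /= addrA; congr (_ + _); last first.
  by rewrite /bump /= add1n subSS subnn binn mulr1n expr0 !mul1r exprS -!mulrA
    mulN1r -exprSr.
rewrite -sumrB; apply: eq_bigr => j _.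
rewrite /bump /= add1n binS mulrnDr subSS; congr (_ + _).
  by rewrite mulrnAr mulrA commr_sign -(subnSK (ltn_ord j)) (exprS x (n - _)) -!mulrA.
by rewrite mulrnAl -mulNrn exprS mulN1r mulNr -!mulrA -exprSr.
Qed.

Lemma sign_bin_pchar (A : nzRingType) (p j : nat) :
  p \in [pchar A] -> (j < p)%N -> (-1) ^+ j *+ 'C(p.-1, j) = 1 :> A.
Proof.
move=> pcharAp; have p_pr := pcharf_prime pcharAp.
elim: j => [|j IHj] ltjp; first by rewrite bin0.
have: 'C(p, j.+1)%:R = 0 :> A.
  by apply/eqP; rewrite -(dvdn_pcharf pcharAp) prime_dvd_bin.
rewrite -{1}(prednK (prime_gt0 p_pr)) binS natrD => /eqP.
rewrite addr_eq0 => /eqP binSj.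
by rewrite -mulr_natr binSj exprS mulN1r mulrNN mulr_natr IHj // ltnW.
Qed.

Lemma iter_commutator_pchar (A : nzRingType) (p : nat) (x z : A) :
  p \in [pchar A] ->
  iter p.-1 (commutator x) z = \sum_(j < p) x ^+ (p.-1 - j) * z * x ^+ j.
Proof.
move=> pcharAp; have p_gt0 := prime_gt0 (pcharf_prime pcharAp).
rewrite iter_commutatorE prednK //; apply: eq_bigr => j _.
by rewrite -mulrnAl sign_bin_pchar ?mul1r.
Qed.

Lemma derivationX (A : nzRingType) (d : A -> A) (x : A) (n : nat) :
  (forall a b, d (a * b) = d a * b + a * d b) -> (0 < n)%N ->
  d (x ^+ n) = \sum_(j < n) x ^+ (n.-1 - j) * d x * x ^+ j.
Proof.
move=> dM; case: n => //= n _; elim: n => [|n IHn]; first by rewrite big_ord1 mul1r mulr1.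
rewrite exprSr dM IHn mulr_suml addrC [RHS]big_ord_recl /= mulr1; congr (_ + _).
by apply: eq_bigr => j _; rewrite /bump /= add1n subSS exprSr !mulrA.
Qed.

Definition primitive (k : fieldType) (U T : algType k)
    (t : U -> U -> T) (D : U -> T) (u : U) : Prop :=
  D u = t u 1 + t 1 u.

Section TensorPowers.
Variables (k : fieldType) (U T : algType k) (t : {bilinear U -> U -> T}).
Hypothesis tT : is_tensor_algebra t.

Lemma tensorXl (u : U) n : t u 1 ^+ n = t (u ^+ n) 1.
Proof.
elim: n => [|n IHn]; first by rewrite !expr0 (tensor1 tT).
by rewrite !exprS IHn (tensorM tT) mulr1.
Qed.

Lemma tensorXr (u : U) n : t 1 u ^+ n = t 1 (u ^+ n).
Proof.
elim: n => [|n IHn]; first by rewrite !expr0 (tensor1 tT).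
by rewrite !exprS IHn (tensorM tT) mulr1.
Qed.

Lemma primitiveX_pchar (D : {lrmorphism U -> T}) (p n : nat) (u : U) :
  p \in [pchar k] -> primitive t D u -> primitive t D (u ^+ (p ^ n)).
Proof.
move=> pcharkp Du; have pcharTp : p \in [pchar T] by rewrite pchar_lalg.
rewrite /primitive rmorphXn /= Du -tensorXl -tensorXr.
have comm_t : GRing.comm (t u 1) (t 1 u).
  by rewrite /GRing.comm !(tensorM tT) !mulr1 !mul1r.
elim: n => [|n IHn]; first by rewrite expn0 !expr1.
rewrite expnSr !exprM IHn -!(pFrobenius_autE pcharTp).
by rewrite pFrobenius_autD_comm //; apply/commrX/commr_sym/commrX/commr_sym.
Qed.

End TensorPowers.

Lemma primitive_frobenius_span (k : fieldType) (p : nat) (g : lieAlgType k)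
    (U T : algType k) (i : {linear g -> U}) (t : {bilinear U -> U -> T})
    (D : {lrmorphism U -> T}) (e : {lrmorphism U -> k^o}) (u : U) :
  p \in [pchar k] -> is_tensor_algebra t -> is_enveloping_coalgebra i t D e ->
  in_frobenius_span i p u -> primitive t D u.
Proof.
move=> pcharkp tT De [s ->]; rewrite /primitive.
rewrite linear_sumlz linear_sumr linear_sum -big_split /=.
apply: eq_bigr => c _; rewrite linearZl_LR linearZr_LR linearZ_LR /= -scalerDr; congr (_ *: _).
exact/(primitiveX_pchar tT)/(coproduct_primitive De).
Qed.

Lemma guin_oudom_primitiveM (k : fieldType) (g : postLieAlgType k)
    (U T : algType k) (i : {linear g -> U}) (t : {bilinear U -> U -> T})
    (D : {lrmorphism U -> T}) (e : {lrmorphism U -> k^o})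
    (r : {bilinear U -> U -> U}) (y : U) :
  is_guin_oudom i t D e r -> primitive t D y ->
  forall a b, r y (a * b) = r y a * b + a * r y b.
Proof.
move=> rGO Dy a b; rewrite (guin_oudomM rGO _ _ (s := [:: (y, 1); (1, y)])).
  by rewrite big_cons big_seq1 /= !(guin_oudom1l rGO).
by rewrite /sweedler Dy big_cons big_seq1.
Qed.

Theorem lemma2p7 (k : fieldType) (p : nat) (hp : p \in [pchar k])
    (g : postLieAlgType k) (U T : algType k)
    (i : {linear g -> U}) (hU : is_enveloping_algebra i)
    (t : {bilinear U -> U -> T}) (hT : is_tensor_algebra t)
    (D : {lrmorphism U -> T}) (e : {lrmorphism U -> k^o})
    (hD : is_enveloping_coalgebra i t D e)
    (r : {bilinear U -> U -> U}) (hr : is_guin_oudom i t D e r)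
    (x y : U) (hx : in_frobenius_span i p x) (hy : in_frobenius_span i p y) :
  r y (x ^+ p) = iter p.-1 (commutator x) (r y x).
Proof.
have pcharUp : p \in [pchar U] by rewrite pchar_lalg.
have Dy := primitive_frobenius_span hp hT hD hy.
rewrite iter_commutator_pchar //.
exact: derivationX (guin_oudom_primitiveM hr Dy) (prime_gt0 (pcharf_prime hp)).
Qed.
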